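(* Let $K$ be a compact Hausdorff space, let $Y$ be a Banach space, and let $\Omega: C(K)\to Y$ be a quasi-linear map. Then either $\Omega$ is locally trivial, or there is a subspace $E\subset C(K)$ isomorphic to $c_0$ such that the restriction $\Omega_{|E}: E\to Y$ is not locally trivial.
   Context: Banach spaces are over a fixed scalar field ($\mathbb R$ or $\mathbb C$), and $C(K)$ is the Banach space of continuous scalar functions on $K$ with the supremum norm. ''Isomorphic'' means linearly homeomorphic. Let $X$ be a normed space and $Y$ a Banach space. A map $\Omega: X\to Y$ (not assumed linear or continuous) is quasi-linear if it is homogeneous, i.e. $\Omega(tx)=t\,\Omega(x)$ for all scalars $t$ and all $x\in X$, and there is a constant $Q$ such that $\|\Omega(x+y)-\Omega(x)-\Omega(y)\|\le Q(\|x\|+\|y\|)$ for all $x,y\in X$. For $\lambda\ge 0$, a quasi-linear map $\Omega:X\to Y$ is $\lambda$-trivial if there is a linear (not necessarily continuous) map $L:X\to Y$ with $\|\Omega-L\|:=\sup_{\|x\|<1}\|\Omega x-Lx\|\le\lambda$. A quasi-linear map $\Omega:X\to Y$ is locally trivial if there is a constant $\lambda$ such that for every finite-dimensional subspace $F$ of $X$ the restriction $\Omega_{|F}:F\to Y$ is $\lambda$-trivial. *)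

(* Defs.v *)
From HB Require Import structures.
From mathcomp Require Import all_boot all_order all_algebra.
From mathcomp Require Import all_classical all_reals all_analysis.
From mathcomp Require Import complex.

Set Implicit Arguments.
Unset Strict Implicit.
Unset Printing Implicit Defensive.
Import Order.TTheory GRing.Theory Num.Theory.
Import numFieldNormedType.Exports.
Local Open Scope classical_set_scope.
Local Open Scope ring_scope.

Variant scalar_kind := RealScalars | ComplexScalars.

Definition scalar_field (R : realType) (k : scalar_kind) : numFieldType :=
  match k with RealScalars => R | ComplexScalars => R[i] end.

Definition scalar_re (R : realType) (k : scalar_kind) :
    scalar_field R k -> R :=
  match k return scalar_field R k -> R with
  | RealScalars => fun x => x
  | ComplexScalars => fun z => complex.Re z
  end.

Definition scalar_of_real (R : realType) (k : scalar_kind) :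
    R -> scalar_field R k :=
  match k return R -> scalar_field R k with
  | RealScalars => fun x => x
  | ComplexScalars => fun x => Complex x 0
  end.
Arguments scalar_of_real {R} k x.

Section ScalarFacts.
Context {R : realType} {k : scalar_kind}.
Local Notation K := (scalar_field R k).

Lemma scalar_reK (x : K) : 0 <= x -> scalar_of_real k (scalar_re x) = x.
Proof.
case: k x => //= -[a b]; rewrite lecE/= => /andP[/eqP b0 _].
by congr Complex; rewrite b0.
Qed.

Lemma scalar_of_realK (x : R) : scalar_re (scalar_of_real k x) = x.
Proof. by case: k. Qed.

Lemma scalar_of_realM (x y : R) :
  scalar_of_real k (x * y) = scalar_of_real k x * scalar_of_real k y.
Proof.
case: k => //=; apply/eqP.
by rewrite eq_complex/= !(mulr0, mul0r) subr0 addr0 !eqxx.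
Qed.

Lemma scalar_of_realD (x y : R) :
  scalar_of_real k (x + y) = scalar_of_real k x + scalar_of_real k y.
Proof. by case: k => //=; apply/eqP; rewrite eq_complex/= addr0 !eqxx. Qed.

Lemma ler_scalar_of_real (x y : R) :
  (scalar_of_real k x <= scalar_of_real k y) = (x <= y).
Proof. by case: k => //=; rewrite lecE/= eqxx. Qed.

Lemma scalar_of_real0 : scalar_of_real k 0 = 0 :> K.
Proof. by case: k. Qed.

(* Library norms take values in the scalar field; rnorm is the same norm with
   values in R, see rnormE. *)
Definition rnorm (V : normedModType K) (x : V) : R := scalar_re `|x|.

Lemma rnormE (V : normedModType K) (x : V) : scalar_of_real k (rnorm x) = `|x|.
Proof. exact: scalar_reK. Qed.

Lemma rnorm_ge0 (V : normedModType K) (x : V) : 0 <= rnorm x.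
Proof. by rewrite -ler_scalar_of_real rnormE scalar_of_real0. Qed.

Lemma rnormD (V : normedModType K) (x y : V) :
  rnorm (x + y) <= rnorm x + rnorm y.
Proof.
by rewrite -ler_scalar_of_real scalar_of_realD !rnormE ler_normD.
Qed.

Lemma rnormZ (V : normedModType K) (a : K) (x : V) :
  rnorm (a *: x) = rnorm (a : K^o) * rnorm x.
Proof.
rewrite -[LHS]scalar_of_realK rnormE normrZ.
by rewrite -[RHS]scalar_of_realK scalar_of_realM !rnormE.
Qed.

Lemma rnorm0_eq0 (V : normedModType K) (x : V) : rnorm x = 0 -> x = 0.
Proof. by move=> x0; apply/normr0_eq0; rewrite -rnormE x0 scalar_of_real0. Qed.

Lemma ltr_scalar_of_real (x y : R) :
  (scalar_of_real k x < scalar_of_real k y) = (x < y).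
Proof. by case: k => //=; rewrite ltcE/= eqxx. Qed.

Lemma rnormN (V : normedModType K) (x : V) : rnorm (- x) = rnorm x.
Proof. by rewrite /rnorm normrN. Qed.

Lemma rnorm_dist (V : normedModType K) (x y : V) :
  `|rnorm x - rnorm y| <= rnorm (x - y).
Proof.
have sub u v : rnorm u - rnorm v <= rnorm (u - v).
  by rewrite lerBlDr -[X in rnorm X <= _](subrK v u) rnormD.
by rewrite ler_norml sub andbT lerNl opprB -(rnormN (x - y)) opprB sub.
Qed.

Lemma rnorm_continuous (V : normedModType K) : continuous (@rnorm V : V -> R).
Proof.
move=> x; apply/cvgrPdist_lt => e e0.
have e0' : 0 < scalar_of_real k e by rewrite -scalar_of_real0 ltr_scalar_of_real.
have /cvgrPdist_lt/(_ _ e0') := @cvg_id _ (nbhs x).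
apply: filterS => y xy; apply: le_lt_trans (rnorm_dist _ _) _.
by rewrite -ltr_scalar_of_real rnormE.
Qed.

End ScalarFacts.

Section SupNorm.
Context {R : realType} {k : scalar_kind} {I : Type}.
Local Notation K := (scalar_field R k).
Implicit Types f g : I -> K^o.

(* When I is empty this is sup set0 = 0. *)
Definition supnorm f : R := sup (range (fun i => rnorm (f i))).

Definition sup_bounded f := has_ubound (range (fun i => rnorm (f i))).

Lemma supnorm_ub f i : sup_bounded f -> rnorm (f i) <= supnorm f.
Proof. by move=> bf; apply: ub_le_sup => //; exists i. Qed.

Lemma supnorm_le f (M : R) : 0 <= M -> (forall i, rnorm (f i) <= M) ->
  supnorm f <= M.
Proof.
move=> M0 fM; have [e|/set0P ne] := eqVneq (range (fun i => rnorm (f i))) set0.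
  by rewrite /supnorm e sup0.
by apply: ge_sup => // _ [i _ <-].
Qed.

Lemma supnorm_ge0 f : 0 <= supnorm f.
Proof.
rewrite /supnorm; have [[ubf bf]|/sup_out->//] :=
  pselect (has_sup (range (fun i => rnorm (f i)))).
have [_ [i _ _]] := ubf.
exact: le_trans (rnorm_ge0 (f i)) (supnorm_ub _ bf).
Qed.

Lemma supnormD f g : sup_bounded f -> sup_bounded g ->
  supnorm (f + g) <= supnorm f + supnorm g.
Proof.
move=> bf bg; apply: supnorm_le; first by rewrite addr_ge0 ?supnorm_ge0.
move=> i; apply: le_trans (rnormD _ _) _.
by apply: lerD; exact: supnorm_ub.
Qed.

Lemma supnormZ (a : K) f : sup_bounded f ->
  supnorm (a *: f) = rnorm (a : K^o) * supnorm f.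
Proof.
move=> bf; apply/eqP; rewrite eq_le; apply/andP; split.
  apply: supnorm_le; first by rewrite mulr_ge0 ?rnorm_ge0 ?supnorm_ge0.
  move=> i; rewrite [X in rnorm X]/(a *: f i) rnormZ.
  by apply: ler_wpM2l; [exact: rnorm_ge0 | exact: supnorm_ub].
have [/eqP a0|a0] := eqVneq (rnorm (a : K^o)) 0.
  by rewrite (eqP a0) mul0r supnorm_ge0.
have {}a0 : 0 < rnorm (a : K^o) by rewrite lt_neqAle eq_sym a0 rnorm_ge0.
rewrite mulrC -ler_pdivlMr//; apply: supnorm_le.
  by rewrite divr_ge0 ?supnorm_ge0 ?rnorm_ge0.
move=> i; rewrite ler_pdivlMr// mulrC -rnormZ.
rewrite -[a *: f i]/((a *: f) i); apply: supnorm_ub.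
case: bf => M fM; exists (rnorm (a : K^o) * M) => _ [j _ <-].
rewrite [X in rnorm X]/(a *: f j) rnormZ.
by apply: ler_wpM2l; [exact: rnorm_ge0 | apply: fM; exists j].
Qed.

Lemma supnorm0_eq0 f : sup_bounded f -> supnorm f = 0 -> f = 0.
Proof.
move=> bf f0; apply/funext => i; apply/rnorm0_eq0/eqP.
by rewrite eq_le rnorm_ge0 -f0 supnorm_ub.
Qed.

End SupNorm.

HB.mixin Record isCompactHausdorff T & Topological T := {
  compactT : compact [set: T];
  hausdorffT : hausdorff_space T
}.

#[short(type="compactHausdorffType")]
HB.structure Definition CompactHausdorff :=
  {T of Topological T & isCompactHausdorff T}.

Section ContinuousFunctions.
Context (R : realType) (k : scalar_kind) (T : compactHausdorffType).
Local Notation K := (scalar_field R k).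

Definition continuous_pred : {pred T -> K^o} := [pred f | `[< continuous f >]].

Lemma continuous_pred_submod : submod_closed continuous_pred.
Proof.
split; first by apply/asboolP => x; exact: cvg_cst.
move=> a f g /asboolP cf /asboolP cg; apply/asboolP => x.
apply: cvgD; last exact: cg.
by apply: cvgZl_tmp; exact: cf.
Qed.

HB.instance Definition _ :=
  GRing.isSubmodClosed.Build K (T -> K^o) continuous_pred continuous_pred_submod.

Definition cfun := {f : T -> K^o | f \in continuous_pred}.

HB.instance Definition _ := SubChoice.on cfun.
HB.instance Definition _ := [SubChoice_isSubLmodule of cfun by <:].

Lemma cfun_bounded (f : cfun) : sup_bounded (val f).
Proof.
have cf : continuous (val f) by apply/asboolP; exact: (valP f).
have crf : continuous (fun t => rnorm (val f t)).
  by move=> t; apply: continuous_comp; [exact: cf | exact: rnorm_continuous].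
have /compact_bounded := continuous_compact (continuous_subspaceT crf) compactT.
move=> /pinfty_ex_gt0[M _ fM]; exists M => _ [t _ <-].
by apply: le_trans (ler_norm _) _; apply: fM; exists t.
Qed.

(* The sup norm, embedded in the scalar field as the library requires. *)
Definition cfun_norm (f : cfun) : K := scalar_of_real k (supnorm (val f)).

Lemma cfun_normD f g : cfun_norm (f + g) <= cfun_norm f + cfun_norm g.
Proof.
rewrite -scalar_of_realD ler_scalar_of_real.
by apply: supnormD; exact: cfun_bounded.
Qed.

Lemma cfun_normZ (a : K) f : cfun_norm (a *: f) = `|a| * cfun_norm f.
Proof.
rewrite -(rnormE (a : K^o)) -scalar_of_realM; congr scalar_of_real.
by apply: supnormZ; exact: cfun_bounded.
Qed.

Lemma cfun_norm0_eq0 f : cfun_norm f = 0 -> f = 0.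
Proof.
move=> /(congr1 (@scalar_re R k)).
rewrite scalar_of_realK -(@scalar_of_real0 R k) scalar_of_realK => f0.
by apply/val_inj/supnorm0_eq0 => //; exact: cfun_bounded.
Qed.

HB.instance Definition _ := Lmodule_isNormed.Build K cfun
  cfun_normD cfun_normZ cfun_norm0_eq0.

Lemma rnorm_cfun (f : cfun) : rnorm f = supnorm (val f).
Proof. exact: scalar_of_realK. Qed.

End ContinuousFunctions.

Section NullSequences.
Context (R : realType) (k : scalar_kind).
Local Notation K := (scalar_field R k).

Definition null_pred : {pred nat -> K^o} :=
  [pred u : nat -> K^o | `[< u @ \oo --> (0 : K^o) >]].

Lemma null_pred_submod : submod_closed null_pred.
Proof.
split; first by apply/asboolP; exact: cvg_cst.
move=> a u v /asboolP cu /asboolP cv; apply/asboolP.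
suff : (a *: u + v) @ \oo --> (a *: (0 : K^o) + 0 : K^o).
  by rewrite scaler0 addr0.
by apply: cvgD; [apply: cvgZl_tmp; exact: cu | exact: cv].
Qed.

HB.instance Definition _ :=
  GRing.isSubmodClosed.Build K (nat -> K^o) null_pred null_pred_submod.

Definition c0 := {u : nat -> K^o | u \in null_pred}.

HB.instance Definition _ := SubChoice.on c0.
HB.instance Definition _ := [SubChoice_isSubLmodule of c0 by <:].

Lemma c0_bounded (u : c0) : sup_bounded (val u).
Proof.
have /asboolP cu : val u \in null_pred by exact: (valP u).
have /cvg_seq_bounded/pinfty_ex_gt0[M M0 uM] :
    cvgn (val u) by apply/cvg_ex; exists 0.
exists (scalar_re M) => _ [n _ <-].
rewrite -(@ler_scalar_of_real R k) rnormE scalar_reK; last exact: ltW.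
exact: uM.
Qed.

Definition c0_norm (u : c0) : K := scalar_of_real k (supnorm (val u)).

Lemma c0_normD u v : c0_norm (u + v) <= c0_norm u + c0_norm v.
Proof.
rewrite -scalar_of_realD ler_scalar_of_real.
by apply: supnormD; exact: c0_bounded.
Qed.

Lemma c0_normZ (a : K) u : c0_norm (a *: u) = `|a| * c0_norm u.
Proof.
rewrite -(rnormE (a : K^o)) -scalar_of_realM; congr scalar_of_real.
by apply: supnormZ; exact: c0_bounded.
Qed.

Lemma c0_norm0_eq0 u : c0_norm u = 0 -> u = 0.
Proof.
move=> /(congr1 (@scalar_re R k)).
rewrite scalar_of_realK -(@scalar_of_real0 R k) scalar_of_realK => u0.
by apply/val_inj/supnorm0_eq0 => //; exact: c0_bounded.
Qed.

HB.instance Definition _ := Lmodule_isNormed.Build K c0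
  c0_normD c0_normZ c0_norm0_eq0.

Lemma rnorm_c0 (u : c0) : rnorm u = supnorm (val u).
Proof. exact: scalar_of_realK. Qed.

End NullSequences.

Section Subspaces.
Context (K : numFieldType) (V : normedModType K) (E : submodClosed V).

(* The subspace E as a normed space in its own right, with the norm of V. *)
Definition sub_space := {x : V | x \in E}.

HB.instance Definition _ := SubChoice.on sub_space.
HB.instance Definition _ := [SubChoice_isSubLmodule of sub_space by <:].

Definition sub_norm (x : sub_space) : K := `|val x|.

Lemma sub_normD x y : sub_norm (x + y) <= sub_norm x + sub_norm y.
Proof. exact: ler_normD. Qed.

Lemma sub_normZ (a : K) x : sub_norm (a *: x) = `|a| * sub_norm x.
Proof. exact: normrZ. Qed.

Lemma sub_norm0_eq0 x : sub_norm x = 0 -> x = 0.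
Proof. by move=> /normr0_eq0 x0; apply: val_inj. Qed.

HB.instance Definition _ := Lmodule_isNormed.Build K sub_space
  sub_normD sub_normZ sub_norm0_eq0.

End Subspaces.

Definition restrict_to (K : numFieldType) (V : normedModType K) (Y : Type)
    (f : V -> Y) (E : submodClosed V) : sub_space E -> Y :=
  fun x => f (val x).
Arguments restrict_to {K V Y} f E x.

Definition finite_dimensional (K : numFieldType) (V : lmodType K) :=
  exists (n : nat) (e : 'I_n -> V),
    forall x : V, exists a : 'I_n -> K, x = \sum_(i < n) a i *: e i.

Definition isomorphic (K : numFieldType) (V W : normedModType K) :=
  exists (f : {linear V -> W}) (g : W -> V),
    [/\ cancel f g, cancel g f, continuous f & continuous g].

Section QuasiLinear.
Context {R : realType} {k : scalar_kind}.
Local Notation K := (scalar_field R k).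
Context {X Y : normedModType K}.
Implicit Types Omega L : X -> Y.

Definition quasi_linear Omega :=
  (forall (t : K) (x : X), Omega (t *: x) = t *: Omega x) /\
  exists Q : R, forall x y : X,
    rnorm (Omega (x + y) - Omega x - Omega y) <= Q * (rnorm x + rnorm y).

(* Omega - L may be unbounded on the open unit ball: the supremum is taken in
   the extended reals. *)
Definition map_dist Omega L : \bar R :=
  ereal_sup [set (rnorm (Omega x - L x))%:E | x in [set x : X | rnorm x < 1]].

Definition trivial_upto (lambda : R) Omega :=
  exists L : {linear X -> Y}, (map_dist Omega L <= lambda%:E)%E.

End QuasiLinear.

Definition locally_trivial {R : realType} {k : scalar_kind}
    {X Y : normedModType (scalar_field R k)} (Omega : X -> Y) :=
  exists2 lambda : R, 0 <= lambda &
    forall F : submodClosed X, finite_dimensional (sub_space F) ->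
      trivial_upto lambda (restrict_to Omega F).

(* Main.v *)
From HB Require Import structures.
From mathcomp Require Import all_boot all_order all_algebra.
From mathcomp Require Import all_classical all_reals all_analysis.
From mathcomp Require Import lra.
Require Import Defs.

Set Implicit Arguments.
Unset Strict Implicit.
Unset Printing Implicit Defensive.
Import Order.TTheory GRing.Theory Num.Theory.
Import numFieldNormedType.Exports.
Local Open Scope classical_set_scope.
Local Open Scope ring_scope.

(** The proof localises the failure of local triviality at a point and then
reproduces it on infinitely many disjoint blocks, each of which is a copy of a
finite-dimensional l_infty space.

Local triviality can be glued: if every point p has an open neighbourhood U p
such that Omega is locally trivial on the functions vanishing off U p, then a
partition of unity phi subordinate to finitely many of the U p writes every f
as the sum of the phi_p f, and approximating Omega on each phi_p f
approximates it on f ([loc_triv_on_glue]).  So if Omega is not locally trivial,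
there is a point p around which Omega is never locally trivial, however small
the neighbourhood U, and this persists for the functions that vanish at p as
well, because they have codimension one ([loc_triv_on_add_point]).

A bad finite family f in that space can be replaced by a better one.  Choosing
finitely many points that resolve the values of f up to a small error e gives
peak functions psi_j with sum at most 1, each equal to 1 at a point pt_j where
the others vanish ([peak_approximation]).  They span an isometric copy of
l_infty, and f is within 2e of its interpolant at the points pt_j.  As the peaks
live where f is larger than e, they vanish on a neighbourhood V of p.  The
coordinates of a function in the span of f can be taken to be evaluations at
points ([eval_coordinates]), hence are bounded by its norm, and so for e small
Omega cannot be nearly linear on the span of psi either ([nontrivial_block]).

Repeating this inside V, so that near linearity with constant n fails on the
n-th block, gives blocks of peak functions with disjoint supports.  Together they behave like the unit
vector basis of c_0 ([c0_embedding], [concat_peak_families]), and Omega is not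
locally trivial on the resulting copy E of c_0 since E contains all blocks. *)

(** * Norms with real values *)

Section RNorm.
Context {R : realType} {k : scalar_kind}.
Local Notation K := (scalar_field R k).

Lemma rnorm0 (V : normedModType K) : rnorm (0 : V) = 0 :> R.
Proof.
rewrite -(scale0r (0 : V)) rnormZ /rnorm normr0.
by rewrite -[0 in LHS](@scalar_of_real0 R k) scalar_of_realK mul0r.
Qed.

Lemma rnorm_sum (V : normedModType K) (I : Type) (r : seq I) (P : pred I)
    (x : I -> V) :
  rnorm (\sum_(i <- r | P i) x i) <= \sum_(i <- r | P i) rnorm (x i).
Proof.
elim/big_rec2: _ => [|i y z _ xy]; first by rewrite rnorm0.
by apply: le_trans (rnormD _ _) _; rewrite lerD2l.
Qed.

Lemma rnormB (V : normedModType K) (x y : V) :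
  rnorm (x - y) <= rnorm x + rnorm y.
Proof. by rewrite -(rnormN y) rnormD. Qed.

Lemma scalar_of_real_ge0 (x : R) : (0 <= scalar_of_real k x) = (0 <= x).
Proof. by rewrite -[0 in LHS](@scalar_of_real0 R k) ler_scalar_of_real. Qed.

Lemma scalar_of_realN (x : R) : scalar_of_real k (- x) = - scalar_of_real k x.
Proof.
apply: (addrI (scalar_of_real k x)).
by rewrite -scalar_of_realD !subrr scalar_of_real0.
Qed.

Lemma rnorm_scalar_of_real (x : R) : rnorm (scalar_of_real k x : K^o) = `|x|.
Proof.
rewrite /rnorm; case: (ger0P x) => x0.
  by rewrite ger0_norm ?scalar_of_realK ?scalar_of_real_ge0.
rewrite -normrN -scalar_of_realN ger0_norm ?scalar_of_realK //.
by rewrite scalar_of_real_ge0 oppr_ge0 ltW.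
Qed.

Lemma scalar_of_real1 : scalar_of_real k (1 : R) = 1 :> K.
Proof. by case: k. Qed.

Lemma rnorm_eq0 (V : normedModType K) (x : V) : (rnorm x == 0 :> R) = (x == 0).
Proof. by apply/eqP/eqP => [/rnorm0_eq0|->]; rewrite ?rnorm0. Qed.

End RNorm.

(** * Near linearity on finite families *)

Section AlmostLinear.
Context {R : realType} {k : scalar_kind}.
Local Notation K := (scalar_field R k).
Context {X Y : normedModType K} (Omega : X -> Y).

Definition lincomb (V : lmodType K) (I : finType) (a : I -> K) (e : I -> V) : V :=
  \sum_i a i *: e i.

(** The values [y i] are those of a linear map at the generators [e i].  The
family [e] may be linearly dependent: when [Omega 0 = 0] the inequality forces
every relation among the [e i] to hold among the [y i], so that [y] does extend
to a linear map on the span.  Encoding linear maps by their values at generators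
avoids extending them from a subspace to the whole space. *)
Definition almost_linear_on (lambda : R) (I : finType) (e : I -> X) :=
  exists y : I -> Y, forall a : I -> K,
    rnorm (Omega (lincomb a e) - lincomb a y) <= lambda * rnorm (lincomb a e).

(** For quasi-linear [Omega] and a linear subspace [A] this is local triviality of
the restriction of [Omega] to [A]. *)
Definition loc_triv_on (A : set X) :=
  exists lambda : R, forall (I : finType) (e : I -> X), (forall i, A (e i)) ->
    almost_linear_on lambda e.

Lemma almost_linear_le (l m : R) (I : finType) (e : I -> X) :
  l <= m -> almost_linear_on l e -> almost_linear_on m e.
Proof.
move=> lm [y ye]; exists y => a; apply: le_trans (ye a) _.
by rewrite ler_wpM2r ?rnorm_ge0.
Qed.

Definition quasi_additive (Q : R) := forall x y : X,
  rnorm (Omega (x + y) - Omega x - Omega y) <= Q * (rnorm x + rnorm y).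

Lemma quasi_linear_additive : quasi_linear Omega ->
  exists2 Q : R, 0 <= Q & quasi_additive Q.
Proof.
move=> [_ [Q hQ]]; exists `|Q| => // x y; apply: le_trans (hQ x y) _.
by rewrite ler_wpM2r ?addr_ge0 ?rnorm_ge0 ?ler_norm.
Qed.

Lemma quasi_linear0 : quasi_linear Omega -> Omega 0 = 0.
Proof. by move=> [h _]; rewrite -(scale0r 0) h scale0r. Qed.

(** The factor [size r] is harmless: the lemma is used for the pieces of a fixed
finite cover, or for summands whose size is chosen after their number. *)
Lemma quasi_additive_sum (Q : R) : 0 <= Q -> Omega 0 = 0 -> quasi_additive Q ->
  forall (I : Type) (r : seq I) (x : I -> X),
  rnorm (Omega (\sum_(i <- r) x i) - \sum_(i <- r) Omega (x i)) <=
    Q * (size r)%:R * \sum_(i <- r) rnorm (x i).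
Proof.
move=> Q0 O0 hQ I; elim=> [|i r IH] x.
  by rewrite !big_nil O0 subrr rnorm0 mulr0.
rewrite !big_cons /=.
set S := \sum_(j <- r) x j; set T := \sum_(j <- r) Omega _.
set n := \sum_(j <- r) rnorm _.
have Sn : rnorm S <= n by exact: rnorm_sum.
have -> : Omega (x i + S) - (Omega (x i) + T) =
    (Omega (x i + S) - Omega (x i) - Omega S) + (Omega S - T).
  by rewrite opprD !addrA subrK.
have xi0 := rnorm_ge0 (x i).
have n0 : 0 <= n by apply: sumr_ge0 => j _; exact: rnorm_ge0.
apply: le_trans (rnormD _ _) _; apply: le_trans (lerD (hQ _ _) (IH x)) _.
rewrite -/n -addn1 natrD.
have r0 : 0 <= (size r)%:R :> R by [].
have rx : 0 <= Q * (size r)%:R * rnorm (x i) by rewrite !mulr_ge0.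
have : Q * rnorm S <= Q * n by rewrite ler_wpM2l.
by rewrite !(mulrDl, mulrDr) !mulr1; lra.
Qed.

End AlmostLinear.

Section LinComb.
Context {R : realType} {k : scalar_kind}.
Local Notation K := (scalar_field R k).

Lemma lincombP (V : lmodType K) (I : finType) (c : K) (a b : I -> K) (e : I -> V) :
  lincomb (fun i => c * a i + b i) e = c *: lincomb a e + lincomb b e.
Proof.
rewrite /lincomb scaler_sumr -big_split; apply: eq_bigr => i _.
by rewrite scalerDl scalerA.
Qed.

Lemma lincombD (V : lmodType K) (I : finType) (a : I -> K) (e f : I -> V) :
  lincomb a (fun i => e i + f i) = lincomb a e + lincomb a f.
Proof. by rewrite -big_split; apply: eq_bigr => i _; rewrite scalerDr. Qed.

Lemma lincomb0 (V : lmodType K) (I : finType) (e : I -> V) :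
  lincomb (fun=> 0) e = 0.
Proof. by rewrite /lincomb big1 // => i _; rewrite scale0r. Qed.

Lemma lincomb_linear (V W : lmodType K) (L : {linear V -> W}) (I : finType)
  (a : I -> K) (e : I -> V) : L (lincomb a e) = lincomb a (L \o e).
Proof. by rewrite linear_sum; apply: eq_bigr => i _; rewrite linearZ. Qed.

End LinComb.

Section Span.
Context (R : realType) (k : scalar_kind).
Local Notation K := (scalar_field R k).
Context (V : lmodType K) (I : finType) (e : I -> V).

Definition span_pred : {pred V} := [pred x | `[< exists a, x = lincomb a e >]].

Lemma span_pred_submod : submod_closed span_pred.
Proof.
split; first by apply/asboolP; exists (fun=> 0); rewrite lincomb0.
move=> c x y /asboolP[a ->] /asboolP[b ->]; apply/asboolP.
by exists (fun i => c * a i + b i); rewrite lincombP.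
Qed.

HB.instance Definition _ :=
  GRing.isSubmodClosed.Build K V span_pred span_pred_submod.

Lemma mem_span_pred i : e i \in span_pred.
Proof.
apply/asboolP; exists (fun j => (j == i)%:R).
rewrite /lincomb (bigD1 i) //= eqxx scale1r big1 ?addr0 // => j /negPf ->.
by rewrite scale0r.
Qed.

End Span.

Section LocallyTrivial.
Context {R : realType} {k : scalar_kind}.
Local Notation K := (scalar_field R k).
Context {X Y : normedModType K}.

Lemma rnorm_sub_space (F : submodClosed X) (x : sub_space F) :
  rnorm x = rnorm (val x).
Proof. by []. Qed.

(** Homogeneity turns a bound on the open unit ball into a bound everywhere: for
[r] slightly larger than the norm of [x], the vector [r^-1 *: x] is in the
ball. *)
Lemma trivial_uptoP (Omega : X -> Y) (lambda : R) :
  0 <= lambda -> (forall (t : K) x, Omega (t *: x) = t *: Omega x) ->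
  trivial_upto lambda Omega <->
  exists L : {linear X -> Y}, forall x, rnorm (Omega x - L x) <= lambda * rnorm x.
Proof.
move=> l0 hom; split=> -[L hL]; exists L; last first.
  apply: ge_ereal_sup => _ [x /= x1 <-]; rewrite lee_fin.
  by apply: le_trans (hL x) _; rewrite ler_piMr // ltW.
move=> x.
suff h r : rnorm x < r -> rnorm (Omega x - L x) <= lambda * r.
  apply/ler_addgt0Pr => e e0.
  have l1 : 0 < lambda + 1 by rewrite ltr_wpDl.
  apply: le_trans (h (rnorm x + e / (lambda + 1)) _) _.
    by rewrite ltrDl divr_gt0.
  rewrite mulrDr lerD2l mulrCA ler_piMr ?(ltW e0) //.
  by rewrite ler_pdivrMr // mul1r lerDl.
move=> xr; have r0 : 0 < r by apply: le_lt_trans xr; exact: rnorm_ge0.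
pose s := scalar_of_real k r^-1.
have ns : rnorm (s : K^o) = r^-1.
  by rewrite rnorm_scalar_of_real ger0_norm // invr_ge0 ltW.
have sx1 : rnorm (s *: x) < 1 by rewrite rnormZ ns mulrC ltr_pdivrMr // mul1r.
have : rnorm (Omega (s *: x) - L (s *: x)) <= lambda.
  by rewrite -lee_fin; apply: le_trans hL; apply: ereal_sup_ubound; exists (s *: x).
by rewrite hom linearZ -scalerBr rnormZ ns mulrC ler_pdivrMr.
Qed.

End LocallyTrivial.

Section LocallyTrivialFamilies.
Context {R : realType} {k : scalar_kind}.
Local Notation K := (scalar_field R k).
Context {X Y : normedModType K}.

Lemma quasi_linear_restrict (Omega : X -> Y) (E : submodClosed X) :
  quasi_linear Omega -> quasi_linear (restrict_to Omega E).
Proof.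
move=> [hom [Q hQ]]; split=> [t x|]; first exact: hom.
by exists Q => x y; exact: hQ.
Qed.

Lemma locally_trivial_loc_triv_on (Omega : X -> Y) : quasi_linear Omega ->
  locally_trivial Omega -> loc_triv_on Omega setT.
Proof.
move=> ql [lambda l0 hl]; exists lambda => I e _.
pose F : submodClosed X := span_pred e.
pose g i : sub_space F := exist _ (e i) (mem_span_pred e i).
have fd : finite_dimensional (sub_space F).
  exists #|I|, (fun i => g (enum_val i)) => x.
  have /asboolP[a xa] := valP x; exists (a \o enum_val).
  apply: val_inj; rewrite xa raddf_sum /=.
  rewrite /lincomb (reindex (@enum_val I xpredT)) //.
  by apply: onW_bij; exact: enum_val_bij.
have [L hL] := (@trivial_uptoP R k (sub_space F) Y _ _ l0
  (quasi_linear_restrict F ql).1).1 (hl F fd).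
exists (L \o g) => a; have := hL (lincomb a g).
have vg : val (lincomb a g) = lincomb a e.
  by rewrite raddf_sum.
by rewrite lincomb_linear rnorm_sub_space /restrict_to vg.
Qed.

(** The coefficients of [x] in a spanning family are chosen without any
regularity; the resulting map is linear because relations among the generators
are respected by their approximate images. *)
Lemma loc_triv_on_locally_trivial (Omega : X -> Y) : quasi_linear Omega ->
  loc_triv_on Omega setT -> locally_trivial Omega.
Proof.
move=> ql [lambda hl]; exists `|lambda| => // F [n [e he]].
apply/(@trivial_uptoP R k (sub_space F) Y) => //.
  exact: (quasi_linear_restrict F ql).1.
have [y hy] := almost_linear_le (ler_norm lambda)
  (hl 'I_n (fun i => val (e i)) (fun=> I)).
have [a ha] := choice he.
have va b : val (lincomb b e) = lincomb b (fun i => val (e i)) by rewrite raddf_sum.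
pose L x := lincomb (a x) y.
have wd b : lincomb b e = 0 -> lincomb b y = 0.
  move=> be0; have := hy b; rewrite -va be0 /= quasi_linear0 //.
  rewrite rnorm0 mulr0 sub0r rnormN => yb.
  by apply/eqP; rewrite -rnorm_eq0 eq_le yb rnorm_ge0.
have linL : linear L.
  move=> c u v; apply/eqP; rewrite -subr_eq0 -scaleN1r /L -lincombP.
  rewrite [X in X == _]addrC -lincombP.
  by apply/eqP/wd; rewrite !lincombP /lincomb -!ha scaleN1r addNr.
pose Llin : {linear sub_space F -> Y} :=
  HB.pack L (GRing.isLinear.Build _ _ _ _ L linL).
exists Llin => x; have := hy (a x); rewrite -va /lincomb -ha.
exact.
Qed.

End LocallyTrivialFamilies.

(** * Continuous functions on a compact space *)

Section Cfun.
Context {R : realType} {k : scalar_kind} {T : compactHausdorffType}.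
Local Notation K := (scalar_field R k).
Local Notation C := (cfun R k T).
Implicit Types (f g : C) (t : T) (h : T -> R).

Lemma scalar_of_real_continuous : continuous (scalar_of_real k : R -> K^o).
Proof.
move=> x; apply/cvgrPdist_lt => e e0.
have re0 : 0 < scalar_re e.
  by rewrite -(@ltr_scalar_of_real R k) scalar_of_real0 scalar_reK ?ltW.
have /cvgrPdist_lt/(_ _ re0) := @cvg_id _ (nbhs x).
apply: filterS => y xy; rewrite -scalar_of_realN -scalar_of_realD.
rewrite -rnormE rnorm_scalar_of_real -(scalar_reK (ltW e0)).
by rewrite ltr_scalar_of_real.
Qed.

Definition cfun_of (F : T -> K^o) (cF : continuous F) : C :=
  exist _ F (introT (asboolP _) cF).

Lemma cfun_continuous f : continuous (val f : T -> K^o).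
Proof. exact/asboolP/(valP f). Qed.

Lemma rnorm_eval f t : rnorm (val f t : K^o) <= rnorm f.
Proof. by rewrite rnorm_cfun; apply: supnorm_ub; exact: cfun_bounded. Qed.

Lemma rnorm_cfun_le f (M : R) : 0 <= M ->
  (forall t, rnorm (val f t : K^o) <= M) -> rnorm f <= M.
Proof. by move=> M0 fM; rewrite rnorm_cfun; exact: supnorm_le. Qed.

Lemma cfun_sum_eval (I : Type) (r : seq I) (F : I -> C) t :
  val (\sum_(i <- r) F i) t = \sum_(i <- r) val (F i) t.
Proof. by elim: r => [|i r IH]; rewrite ?big_nil // !big_cons -IH. Qed.

Lemma lincomb_eval (I : finType) (a : I -> K) (e : I -> C) t :
  val (lincomb a e) t = \sum_i a i * val (e i) t.
Proof. exact: cfun_sum_eval. Qed.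

Definition real_cfun h (ch : continuous h) : C :=
  @cfun_of (fun t => scalar_of_real k (h t))
   (fun t => continuous_comp (ch t) (@scalar_of_real_continuous (h t))).

Lemma mul_cfun_continuous f g :
  continuous (fun t => val f t * val g t : K^o).
Proof. by move=> t; apply: cvgM; exact: cfun_continuous. Qed.

Definition mul_cfun f g : C := cfun_of (@mul_cfun_continuous f g).

Lemma lincomb_mul_cfun f (I : finType) (a : I -> K) (e : I -> C) :
  lincomb a (fun i => mul_cfun f (e i)) = mul_cfun f (lincomb a e).
Proof.
apply/val_inj/funext => t; rewrite lincomb_eval /= lincomb_eval mulr_sumr.
by apply: eq_bigr => i _; rewrite mulrCA.
Qed.

Definition supported_in (U : set T) : set C :=
  [set f | forall t, ~ U t -> val f t = 0].

Lemma cfun_urysohn (U : set T) t : open U -> U t ->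
  exists h : T -> R, [/\ continuous h, forall s, 0 <= h s <= 1, h t = 1 &
    forall s, ~ U s -> h s = 0].
Proof.
move=> oU Ut.
have cr : completely_regular_space T.
  apply: (@normal_completely_regular R).
    by apply: compact_normal; [exact: hausdorffT|exact: compactT].
  by apply: hausdorff_accessible; exact: hausdorffT.
have clU : closed (~` U) by rewrite closedC.
have /(@uniform_separatorP _ R)[h [ch h01 h0 h1]] := cr t (~` U) clU (fun n => n Ut).
exists (fun s => 1 - h s); split.
- by move=> s; apply: cvgB; [exact: cvg_cst|exact: ch].
- move=> s; have : `[0, 1]%classic (h s) by apply: h01; exists s.
  by rewrite /= in_itv /= => /andP[? ?]; apply/andP; split; lra.
- by rewrite (h0 (h t)) ?subr0 //; exists t.
- by move=> s Us; rewrite (h1 (h s)) ?subrr //; exists s.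
Qed.

Lemma continuous_sum (I : Type) (r : seq I) (F : I -> T -> R) :
  (forall i, continuous (F i)) -> continuous (fun t => \sum_(i <- r) F i t).
Proof.
move=> cF; elim: r => [|i r IH] t.
  under eq_fun do rewrite big_nil; exact: cvg_cst.
under eq_fun do rewrite big_cons.
by apply: cvgD; [exact: cF|exact: IH].
Qed.

End Cfun.

(** * Gluing local triviality *)

Lemma compact_finite_cover (T : topologicalType) (A : set T) (U : T -> set T) :
  compact A -> (forall t, A t -> open (U t) /\ U t t) ->
  exists r : seq T, (forall p, p \in r -> A p) /\
    forall t, A t -> exists2 p, p \in r & U p t.
Proof.
move=> cA hU; have [[t0 At0]|noA] := pselect (A !=set0); last first.
  by exists [::]; split=> // t At; case: noA; exists t.
pose P : ptopologicalType := HB.pack T (isPointed.Build T t0).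
have : @cover_compact P A by rewrite -(compact_cover P).
move=> /(_ T A U (fun t At => (hU t At).1)).
case=> [t At|D DA cov]; first by exists t => //; exact: (hU t At).2.
exists (finmap.enum_fset D); split=> [p pD|t At].
  by apply/set_mem/DA.
by have [p pD Upt] := cov t At; exists p.
Qed.

Section Gluing.
Context {R : realType} {k : scalar_kind} {T : compactHausdorffType}.
Local Notation K := (scalar_field R k).
Local Notation C := (cfun R k T).
Context {Y : normedModType K} (Omega : C -> Y).

Lemma rnorm_mul_real_cfun (h : T -> R) (ch : continuous h) (f : C) :
  (forall t, `|h t| <= 1) -> rnorm (mul_cfun (real_cfun ch : C) f) <= rnorm f.
Proof.
move=> h1; apply: rnorm_cfun_le => [|t]; first exact: rnorm_ge0.
rewrite /= [X in rnorm X]/(_ *: (val f t : K^o)) rnormZ rnorm_scalar_of_real.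
by apply: le_trans (rnorm_eval f t); rewrite ler_piMl // rnorm_ge0.
Qed.

Lemma scalar_of_real_sum (I : Type) (r : seq I) (F : I -> R) :
  scalar_of_real k (\sum_(i <- r) F i) = \sum_(i <- r) scalar_of_real k (F i).
Proof.
by elim/big_rec2: _ => [|i y z _ <-]; rewrite ?scalar_of_real0 // scalar_of_realD.
Qed.

Lemma lincomb_sum (V : lmodType K) (I : finType) (J : Type) (r : seq J)
    (a : I -> K) (y : J -> I -> V) :
  lincomb a (fun i => \sum_(j <- r) y j i) = \sum_(j <- r) lincomb a (y j).
Proof.
rewrite /lincomb exchange_big /=; apply: eq_bigr => i _.
by rewrite scaler_sumr.
Qed.

(** Normalised Urysohn functions.  Outside the finite set of centres [phi] is set
to zero, which keeps its values in the unit interval at every index. *)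
Lemma partition_of_unity (U : T -> set T) :
  (forall p, open (U p) /\ U p p) ->
  exists (r : seq T) (phi : T -> C),
    [/\ forall p, supported_in (U p) (phi p),
        forall p f, rnorm (mul_cfun (phi p) f) <= rnorm f &
        forall f, \sum_(p <- r) mul_cfun (phi p) f = f].
Proof.
move=> hU.
have [h hh] := choice (fun p => cfun_urysohn (R := R) (hU p).1 (hU p).2).
have ch p : continuous (h p) by case: (hh p).
have h01 p s : 0 <= h p s <= 1 by case: (hh p).
pose V p := [set t | 0 < h p t].
have oV p : open (V p).
  exact: (open_comp (fun t _ => ch p t) (@open_gt R 0)).
have [r [_ covD]] : exists r : seq T, (forall p, p \in r -> [set: T] p) /\
    forall t, [set: T] t -> exists2 p, p \in r & V p t.
  apply: compact_finite_cover; first exact: compactT.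
  by move=> p _; split=> //; rewrite /V /=; have [_ _ -> _] := hh p.
pose S t := \sum_(p <- r) h p t.
have S0 t : 0 < S t.
  have [p pD hp] := covD t I.
  rewrite /S (big_rem p) //=; apply: ltr_pwDl; first exact: hp.
  by apply: sumr_ge0 => q _; have /andP[] := h01 q t.
have hS t p : p \in r -> h p t <= S t.
  move=> pr; rewrite /S (big_rem p) //= lerDl.
  by apply: sumr_ge0 => q _; have /andP[] := h01 q t.
have cS : continuous S by exact: continuous_sum.
have cM p : continuous (fun t => if p \in r then h p t / S t else 0).
  move=> t; case: (p \in r); last exact: cvg_cst.
  apply: cvgM; first exact: ch.
  by apply: cvgV; [rewrite gt_eqF|exact: cS].
exists r, (fun p => real_cfun (@cM p)); split.
- move=> p t Ut /=; have [_ _ _ ->//] := hh p.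
  by rewrite mul0r if_same scalar_of_real0.
- move=> p f; apply: rnorm_mul_real_cfun => t.
  case: ifP => [pr|_]; last by rewrite normr0.
  have /andP[h0 _] := h01 p t.
  by rewrite ger0_norm ?divr_ge0 ?(ltW (S0 t)) // ler_pdivrMr // mul1r hS.
- move=> f; apply/val_inj/funext => t; rewrite cfun_sum_eval /=.
  rewrite -mulr_suml -scalar_of_real_sum (_ : \sum_(p <- r) _ = 1).
    by rewrite scalar_of_real1 mul1r.
  rewrite big_seq (eq_bigr (fun p => h p t / S t)); last by move=> p ->.
  by rewrite -big_seq -mulr_suml divff //; apply: lt0r_neq0; exact: S0.
Qed.

Context (ql : quasi_linear Omega).

(** Multiplication by [phi p] is linear and contractive, and it sends any family to
one supported in [U p].  Linear maps near [Omega] for these families add up to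
one near [Omega] for the family itself. *)
Lemma loc_triv_on_glue :
  (forall p, exists U, [/\ open U, U p & loc_triv_on Omega (supported_in U)]) ->
  loc_triv_on Omega setT.
Proof.
move=> /choice[U hU].
have [Q Q0 hQ] := quasi_linear_additive ql.
have [r [phi [sphi nphi phi1]]] : exists (r : seq T) (phi : T -> C),
    [/\ forall p, supported_in (U p) (phi p),
        forall p f, rnorm (mul_cfun (phi p) f) <= rnorm f &
        forall f, \sum_(p <- r) mul_cfun (phi p) f = f].
  by apply: partition_of_unity => p; have [] := hU p.
have /choice[l hl] p : exists l, forall (I : finType) (e : I -> C),
    (forall i, supported_in (U p) (e i)) -> almost_linear_on Omega l e.
  by have [_ _ []] := hU p; move=> l; exists l.
exists (Q * (size r)%:R * (size r)%:R + \sum_(p <- r) `|l p|) => I e _.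
have /choice[y hy] p : exists y : I -> Y, forall a,
    rnorm (Omega (mul_cfun (phi p) (lincomb a e)) - lincomb a y) <=
    `|l p| * rnorm (lincomb a e).
  have [i t Ut|y hy] := hl p I (fun i => mul_cfun (phi p) (e i)).
    by rewrite /= sphi // mul0r.
  exists y => a; have := hy a; rewrite lincomb_mul_cfun => /le_trans; apply.
  apply: le_trans (ler_wpM2l (normr_ge0 _) (nphi p _)).
  by rewrite ler_wpM2r ?rnorm_ge0 // ler_norm.
exists (fun i => \sum_(p <- r) y p i) => a.
set x := lincomb a e; rewrite lincomb_sum.
have -> : Omega x - \sum_(p <- r) lincomb a (y p) =
    (Omega (\sum_(p <- r) mul_cfun (phi p) x) -
      \sum_(p <- r) Omega (mul_cfun (phi p) x)) +
    \sum_(p <- r) (Omega (mul_cfun (phi p) x) - lincomb a (y p)).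
  by rewrite phi1 sumrB addrA subrK.
apply: le_trans (rnormD _ _) _; rewrite mulrDl; apply: lerD.
  apply: le_trans (quasi_additive_sum Q0 (quasi_linear0 ql) hQ _ _) _.
  rewrite -!mulrA; do 2!apply: ler_wpM2l => //.
  apply: le_trans (ler_sum _ (fun p _ => nphi p x)) _.
  by rewrite big_const_seq count_predT iter_addr addr0 mulr_natl.
apply: le_trans (rnorm_sum _ _ _) _; rewrite mulr_suml.
by apply: ler_sum => p _; exact: hy.
Qed.

(** A bump function [g] at [p] splits every function into a multiple of [g] and a
function vanishing at [p]; both parts are controlled by the norm, so this extra
dimension costs a fixed multiple of the quasi-linearity constant. *)
Lemma loc_triv_on_add_point (U : set T) p : open U -> U p ->
  loc_triv_on Omega (supported_in (U `\ p)) ->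
  loc_triv_on Omega (supported_in U).
Proof.
move=> oU Up [l hl]; have [Q Q0 hQ] := quasi_linear_additive ql.
have [h [ch h01 hp hU]] := cfun_urysohn (R := R) oU Up.
pose g : C := real_cfun ch.
have g1 : rnorm g <= 1.
  apply: rnorm_cfun_le => // t; rewrite /= rnorm_scalar_of_real.
  by have /andP[? ?] := h01 t; rewrite ger0_norm.
exists (3 * Q + `|l| * 2) => I e he.
have [i t|y hy] := hl I (fun i => e i - (val (e i) p) *: g).
  rewrite /setD /= => /not_andP Ut.
  change (val (e i) t - val (e i) p * val g t = 0).
  have [Ut'|/contrapT ->] : ~ U t \/ ~ t <> p by case: Ut; tauto.
    by rewrite /= he // hU // scalar_of_real0 mulr0 subrr.
  by rewrite /= hp scalar_of_real1 mulr1 subrr.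
exists (fun i => y i + val (e i) p *: Omega g) => a.
set x := lincomb a e; pose z := x - val x p *: g.
have zE : lincomb a (fun i => e i - val (e i) p *: g) = z.
  rewrite /z /x lincomb_eval /lincomb scaler_suml -sumrB.
  by apply: eq_bigr => i _; rewrite scalerBr scalerA.
have -> : lincomb a (fun i => y i + val (e i) p *: Omega g) =
    lincomb a y + Omega (val x p *: g).
  rewrite ql.1 /x lincomb_eval /lincomb scaler_suml -big_split.
  by apply: eq_bigr => i _; rewrite scalerDr scalerA.
have xpg : rnorm (val x p *: g) <= rnorm x.
  rewrite rnormZ -[leRHS]mulr1; apply: ler_pM; rewrite ?rnorm_ge0 //.
  exact: rnorm_eval.
have z2 : rnorm z <= 2 * rnorm x.
  by apply: le_trans (rnormB _ _) _; lra.
have -> : Omega x - (lincomb a y + Omega (val x p *: g)) =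
  (Omega (z + val x p *: g) - Omega z - Omega (val x p *: g)) +
  (Omega z - lincomb a y).
  rewrite /z subrK !opprD !addrA.
  set A := Omega x; set B := Omega _; set D := Omega _; set E := lincomb _ _.
  by rewrite (addrAC A (- D)) subrK addrAC.
have := hy a; rewrite zE => hy'.
have xx := rnorm_ge0 x; have zz := rnorm_ge0 z.
apply: le_trans (rnormD _ _) _.
have hQ' := hQ z (val x p *: g).
have Q1 : Q * (rnorm z + rnorm (val x p *: g)) <= Q * (3 * rnorm x).
  by apply: ler_wpM2l => //; lra.
have l1 : l * rnorm z <= `|l| * (2 * rnorm x).
  apply: le_trans (ler_wpM2l (normr_ge0 l) z2).
  by rewrite ler_wpM2r // ler_norm.
lra.
Qed.

End Gluing.

(** * Coordinates given by evaluations *)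

Section EvaluationCoordinates.
Context {R : realType} {k : scalar_kind} {T : compactHausdorffType}.
Local Notation K := (scalar_field R k).
Local Notation C := (cfun R k T).

Definition interp (r : seq (C * T)) (x : C) : C :=
  \sum_(q <- r) val x q.2 *: q.1.

Lemma interp_lincomb (r : seq (C * T)) (I : finType) (a : I -> K) (e : I -> C) :
  interp r (lincomb a e) = lincomb a (fun i => interp r (e i)).
Proof.
rewrite lincomb_sum; apply: eq_bigr => q _.
rewrite lincomb_eval /lincomb scaler_suml; apply: eq_bigr => i _.
by rewrite scalerA.
Qed.

(** Coordinates that are point evaluations are bounded by the norm, which replaces
the equivalence of norms on finite-dimensional spaces.  The construction is
Newton interpolation: when the next function [e] is not reproduced, the residue
[g] is nonzero at some [t]; normalised at [t] it becomes a new interpolating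
function, and the previous ones are corrected so as to vanish at [t]. *)
Lemma eval_coordinates (S : set C) (s : seq C) :
  (forall a f g, S f -> S g -> S (a *: f + g)) -> S 0 ->
  (forall f, f \in s -> S f) ->
  exists r : seq (C * T), (forall q, q \in r -> S q.1) /\
    forall f, f \in s -> interp r f = f.
Proof.
move=> Slin S0; have SZ a f : S f -> S (a *: f).
  by move=> Sf; rewrite -[_ *: _]addr0; exact: Slin.
elim: s => [|e s IH] hs; first by exists [::].
have [|r [Sr hr]] := IH; first by move=> f fs; apply: hs; rewrite inE fs orbT.
have Se : S e by apply: hs; rewrite mem_head.
pose g := e - interp r e.
have Sg : S g.
  rewrite /g addrC -scaleN1r; apply: (Slin) => //.
  rewrite /interp big_seq; apply: (big_ind S) => // [x y Sx Sy|q qr].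
    by rewrite -[x]scale1r; exact: Slin.
  by apply: SZ; exact: Sr.
have [g0|/eqP gN0] := pselect (g = 0).
  exists r; split=> // f; rewrite inE => /predU1P[->|/hr//].
  by apply/esym/eqP; rewrite -subr_eq0; exact/eqP.
have [t gt] : exists t, val g t != 0.
  apply: contrapT => h; apply: (negP gN0); apply/eqP/val_inj/funext => t.
  by apply: contrapT => /eqP gt; apply: h; exists t.
pose g' := (val g t)^-1 *: g.
have Sg' : S g' by exact: SZ.
exists ((g', t) :: [seq (q.1 - val q.1 t *: g', q.2) | q <- r]); split.
  move=> q; rewrite inE => /predU1P[->//|/mapP[p pr ->] /=].
  by rewrite addrC -scaleNr; apply: (Slin) => //; exact: Sr.
(* With c = 0 this handles the functions that are already reproduced, and with
c = 1 the new function. *)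
have key f c : f = interp r f + c *: g ->
    interp ((g', t) :: [seq (q.1 - val q.1 t *: g', q.2) | q <- r]) f = f.
  move=> fE; rewrite /interp big_cons big_map /=.
  under eq_bigr do rewrite scalerBr scalerA.
  rewrite sumrB -scaler_suml -/(interp r f).
  have -> : \sum_(q <- r) val f q.2 * val q.1 t = val (interp r f) t.
    by rewrite /interp cfun_sum_eval.
  rewrite addrCA -scalerBl.
  have -> : val f t - val (interp r f) t = c * val g t.
    rewrite {1}fE.
    change (val (interp r f) t + c * val g t - val (interp r f) t = c * val g t).
    by rewrite addrAC subrr add0r.
  by rewrite scalerA mulfK // -fE.
move=> f; rewrite inE => /predU1P[->|fs].
  by apply: (key _ 1); rewrite scale1r addrC subrK.
by apply: (key _ 0); rewrite scale0r addr0 hr.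
Qed.

End EvaluationCoordinates.

(** * Peak functions *)

Section PeakFamilies.
Context {R : realType} {k : scalar_kind} {T : compactHausdorffType}.
Local Notation K := (scalar_field R k).
Local Notation C := (cfun R k T).

(** The span of such a family is isometric to a finite-dimensional l_infty space:
the sup norm of a combination is the largest modulus of its coefficients, which
are its values at the points [pt j]. *)
Definition peak_family (J : finType) (psi : J -> C) (pt : J -> T) :=
  (forall t, \sum_j rnorm (val (psi j) t : K^o) <= 1) /\
  (forall i j, val (psi i) (pt j) = (i == j)%:R).

Definition variation (F : seq C) (s t : T) : R :=
  \sum_(g <- F) rnorm (val g s - val g t : K^o).

Definition total_size (F : seq C) (t : T) : R :=
  \sum_(g <- F) rnorm (val g t : K^o).

Lemma rnorm_comp_continuous (G : T -> K^o) :
  continuous G -> continuous (fun t => rnorm (G t)).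
Proof.
by move=> cG t; apply: continuous_comp; [exact: cG|exact: rnorm_continuous].
Qed.

Lemma variation_continuous F s : continuous (variation F s).
Proof.
apply: continuous_sum => g; apply: rnorm_comp_continuous => t.
by apply: cvgB; [exact: cvg_cst|exact: cfun_continuous].
Qed.

Lemma total_size_continuous F : continuous (total_size F).
Proof.
by apply: continuous_sum => g; apply: rnorm_comp_continuous; exact: cfun_continuous.
Qed.

Lemma variation_ge F (g : C) s t : g \in F ->
  rnorm (val g s - val g t : K^o) <= variation F s t.
Proof.
move=> gF; rewrite /variation (big_rem g) //= lerDl.
by apply: sumr_ge0 => i _; exact: rnorm_ge0.
Qed.

Lemma total_size_ge F (g : C) t : g \in F ->
  rnorm (val g t : K^o) <= total_size F t.
Proof.
move=> gF; rewrite /total_size (big_rem g) //= lerDl.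
by apply: sumr_ge0 => i _; exact: rnorm_ge0.
Qed.

Lemma total_size_le F s t : total_size F s <= variation F s t + total_size F t.
Proof.
rewrite /total_size /variation -big_split; apply: ler_sum => g _.
by rewrite -[X in rnorm X](subrK (val g t)) rnormD.
Qed.

(** Take a net with the least number of centres.  Leaving out the centre [s j]
uncovers some point, and this point serves as [pt j]. *)
Lemma minimal_net (A : set T) (d : T -> T -> R) (e : R) : compact A ->
  (forall s, continuous (d s)) -> (forall s, d s s < e) ->
  exists (m : nat) (s pt : 'I_m -> T),
    [/\ forall j, A (s j) /\ A (pt j),
        forall t, A t -> exists j, d (s j) t < e &
        forall i j, i != j -> e <= d (s i) (pt j)].
Proof.
move=> cA cd d0.
pose net m (s : 'I_m -> T) := (forall j, A (s j)) /\
  forall t, A t -> exists j, d (s j) t < e.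
have exm : exists m, `[< exists s : 'I_m -> T, net m s >].
  have [|r [rA rcov]] := @compact_finite_cover T A (fun s => [set t | d s t < e]) cA.
    move=> s _; split; last exact: d0.
    exact: (open_comp (fun t _ => cd s t) (@open_lt R e)).
  exists (size r); apply/asboolP; exists (tnth (in_tuple r)); split.
    by move=> j; apply: rA; exact: mem_tnth.
  move=> t /rcov[p pr dp].
  by have /tnthP[j pj] : p \in in_tuple r by []; exists j; rewrite -pj.
case: (ex_minnP exm) => m /asboolP[s [sA scov]] mmin.
have far j : exists t, A t /\ forall i, i != j -> e <= d (s i) t.
  case: m s sA scov mmin j => [? ? ? ? []//|m] s sA scov mmin j.
  apply: contrapT => nof; suff : (m.+1 <= m)%N by rewrite ltnn.
  apply: mmin; apply/asboolP; exists (s \o lift j); split=> [i|t At].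
    exact: sA.
  apply: contrapT => noi; apply: nof; exists t; split=> // i.
  case: (unliftP j i) => [i' ->|->]; last by rewrite eqxx.
  by move=> _; rewrite leNgt; apply/negP => di; apply: noi; exists i'.
have [pt hpt] := choice far.
exists m, s, pt; split=> //.
  by move=> j; split; [exact: sA|exact: (hpt j).1].
by move=> i j ij; exact: (hpt j).2.
Qed.

(** The tent functions [th j] around the centres of a minimal net, together with
[th0] which covers the region where all functions of [F] are small, have a
positive sum; dividing by it gives a partition of unity.  Only [th j] is nonzero
at [pt j], so its quotient takes the value 1 there.  Discarding the quotient of
[th0] costs at most [2 * e] because it lives where [F] is small. *)
Lemma peak_approximation (F : seq C) (e : R) : 0 < e ->
  exists (J : finType) (psi : J -> C) (pt : J -> T),
    [/\ peak_family psi pt,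
        forall j t, val (psi j) t != 0 -> e < total_size F t &
        forall g, g \in F ->
          rnorm (g - lincomb (fun j => val g (pt j)) psi) <= 2 * e].
Proof.
move=> e0.
pose A := [set t | 2 * e <= total_size F t].
have cA : compact A.
  have clA : closed A.
    apply: (@closed_comp _ _ (total_size F) [set x | 2 * e <= x]).
      by move=> t _; exact: total_size_continuous.
    exact: closed_ge.
  exact: subclosed_compact clA compactT _.
have d0 s : variation F s s < e.
  by rewrite /variation big1 // => g _; rewrite subrr rnorm0.
have [m [s [pt [Asp cov sep]]]] :=
  minimal_net cA (fun s => @variation_continuous F s) d0.
pose th0 t := Num.max 0 (2 * e - total_size F t).
pose th j t := Num.max 0 (e - variation F (s j) t).
have th0_ge0 t : 0 <= th0 t by rewrite le_max lexx.
have th_ge0 j t : 0 <= th j t by rewrite le_max lexx.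
have cth0 : continuous th0.
  move=> t; apply: (@continuous_max _ _ (fun=> 0) (fun t => 2 * e - total_size F t)).
    exact: cvg_cst.
  by apply: cvgB; [exact: cvg_cst|exact: total_size_continuous].
have cth j : continuous (th j).
  move=> t; apply: (@continuous_max _ _ (fun=> 0)
    (fun t => e - variation F (s j) t)).
    exact: cvg_cst.
  by apply: cvgB; [exact: cvg_cst|exact: variation_continuous].
pose Th t := th0 t + \sum_j th j t.
have cTh : continuous Th.
  by move=> t; apply: cvgD; [exact: cth0|exact: continuous_sum].
have Th_gt0 t : 0 < Th t.
  have [At|nAt] := leP (2 * e) (total_size F t).
    have [j dj] := cov t At.
    rewrite /Th (bigD1 j) //= addrCA; apply: ltr_pwDl.
      by rewrite lt_max subr_gt0 dj orbT.
    by rewrite addr_ge0 // sumr_ge0.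
  by rewrite ltr_pwDl ?sumr_ge0 // lt_max subr_gt0 nAt orbT.
have cq j : continuous (fun t => th j t / Th t).
  move=> t; apply: cvgM; first exact: cth.
  by apply: cvgV; [rewrite gt_eqF|exact: cTh].
have q_ge0 j t : 0 <= th j t / Th t by rewrite divr_ge0 // ltW.
have sumq t : th0 t / Th t + \sum_j th j t / Th t = 1.
  by rewrite -mulr_suml -mulrDl divff //; apply: lt0r_neq0; exact: Th_gt0.
exists 'I_m, (fun j => real_cfun (@cq j)), pt; split; first split.
- move=> t; rewrite /= (eq_bigr (fun j => th j t / Th t)); last first.
    by move=> j _; rewrite rnorm_scalar_of_real ger0_norm.
  by rewrite -(sumq t) lerDr divr_ge0 // ltW.
- move=> i j /=.
  have thij l : l != j -> th l (pt j) = 0.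
    by move=> lj; apply/max_idPl; rewrite subr_le0 sep.
  have [->|ij] := eqVneq i j; last by rewrite thij // mul0r scalar_of_real0.
  have th00 : th0 (pt j) = 0 by apply/max_idPl; rewrite subr_le0 (Asp j).2.
  have := sumq (pt j); rewrite th00 mul0r add0r (bigD1 j) //= big1 ?addr0.
    by move->; rewrite scalar_of_real1.
  by move=> l lj; rewrite thij // mul0r.
- move=> j t /= qN0.
  have dj : variation F (s j) t < e.
    rewrite ltNge; apply: contra qN0 => le; rewrite /th (max_idPl _) ?subr_le0 //.
    by rewrite mul0r scalar_of_real0.
  (* The net consists of points where the total size is at least 2 e, and the
  tent around s j only reaches points at variation less than e from s j. *)
  have [As _] := Asp j; have := total_size_le F (s j) t.
  by move: As; rewrite /A /=; lra.
- move=> g gF; apply: rnorm_cfun_le => [|t]; first by rewrite mulr_ge0 // ltW.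
  change (rnorm (val g t - val (lincomb (fun j => val g (pt j))
     (fun j => real_cfun (@cq j))) t : K^o) <= 2 * e).
  rewrite lincomb_eval /=.
  have gE : val g t = scalar_of_real k (th0 t / Th t) * val g t +
     \sum_j scalar_of_real k (th j t / Th t) * val g t.
    by rewrite -mulr_suml -mulrDl -scalar_of_real_sum -scalar_of_realD sumq
      scalar_of_real1 mul1r.
  rewrite {1}gE -addrA -sumrB.
  apply: le_trans (rnormD _ _) _.
  have eE : 2 * e = th0 t / Th t * (2 * e) + (\sum_j th j t / Th t) * (2 * e).
    by rewrite -mulrDl sumq mul1r.
  rewrite [leRHS]eE; apply: lerD.
    rewrite [X in rnorm X]/(_ *: (val g t : K^o)) rnormZ rnorm_scalar_of_real.
    rewrite ger0_norm ?divr_ge0 ?(ltW (Th_gt0 t)) //.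
    have [small|big] := ltP (total_size F t) (2 * e).
      apply: ler_wpM2l; first by rewrite divr_ge0 // ltW.
      exact: le_trans (total_size_ge t gF) (ltW small).
    by rewrite /th0 (max_idPl _) ?subr_le0 // !mul0r.
  apply: le_trans (rnorm_sum _ _ _) _; rewrite mulr_suml.
  apply: ler_sum => j _; rewrite (mulrC (val g (pt j))) -mulrBr.
  rewrite [X in rnorm X]/(_ *: (_ : K^o)) rnormZ rnorm_scalar_of_real ger0_norm //.
  have [small|big] := ltP (variation F (s j) t) e; last first.
    by rewrite /th (max_idPl _) ?subr_le0 // !mul0r.
  apply: ler_wpM2l => //.
  have [j' dj'] := cov _ (Asp j).2.
  have jj' : j' = j.
    by apply: contraTeq dj' => ne; rewrite -leNgt sep.
  rewrite jj' in dj'.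
  have -> : val g t - val g (pt j) =
     (val g (s j) - val g (pt j)) - (val g (s j) - val g t).
    by rewrite opprB [RHS]addrC addrA subrK.
  apply: le_trans (rnormB _ _) _.
  have := variation_ge (s j) t gF; have := variation_ge (s j) (pt j) gF; lra.
Qed.

End PeakFamilies.

(** * Blocks near a bad point *)

Section Blocks.
Context {R : realType} {k : scalar_kind} {T : compactHausdorffType}.
Local Notation K := (scalar_field R k).
Local Notation C := (cfun R k T).
Context {Y : normedModType K} (Omega : C -> Y).

Lemma rnorm_lincomb_peak (J : finType) (psi : J -> C) (pt : J -> T)
    (a : J -> K) (M : R) : peak_family psi pt -> 0 <= M ->
  (forall j, rnorm (a j : K^o) <= M) -> rnorm (lincomb a psi) <= M.
Proof.
move=> [psi1 _] M0 aM; apply: rnorm_cfun_le => // t; rewrite lincomb_eval.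
apply: le_trans (rnorm_sum _ _ _) _.
apply: le_trans (_ : M * \sum_j rnorm (val (psi j) t : K^o) <= _); last first.
  by rewrite -[leRHS]mulr1 ler_wpM2l.
rewrite mulr_sumr; apply: ler_sum => j _.
rewrite [X in rnorm X]/(_ *: (_ : K^o)) rnormZ.
by apply: ler_wpM2r; rewrite ?rnorm_ge0.
Qed.

(** Interpolation at the points [pt j]; a contraction when [psi] is a peak
family. *)
Definition sample (J : finType) (psi : J -> C) (pt : J -> T) (x : C) : C :=
  lincomb (fun j => val x (pt j)) psi.

Lemma rnorm_sample (J : finType) (psi : J -> C) (pt : J -> T) (x : C) :
  peak_family psi pt -> rnorm (sample psi pt x) <= rnorm x.
Proof.
move=> pk; apply: (rnorm_lincomb_peak pk) => [|j]; first exact: rnorm_ge0.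
exact: rnorm_eval.
Qed.

Lemma sample_lincomb (W : lmodType K) (J : finType) (w : J -> W) (pt : J -> T)
    (I : finType) (a : I -> K) (e : I -> C) :
  lincomb a (fun i => lincomb (fun j => val (e i) (pt j)) w) =
  lincomb (fun j => val (lincomb a e) (pt j)) w.
Proof.
rewrite /lincomb; under eq_bigr do rewrite scaler_sumr.
rewrite exchange_big; apply: eq_bigr => j _ /=.
rewrite -/(lincomb a e) lincomb_eval scaler_suml.
by apply: eq_bigr => i _; rewrite scalerA.
Qed.

(** Write a function [x] of the span as [sample psi pt x] plus a remainder.  The
first part is in the span of [psi].  The remainder is the combination, with
coefficients [val x q.2] bounded by the norm of [x], of the vectors [D q]; these
are small, so [Omega] may be replaced there by its values at the [D q].  The
term [3 * Q] is the price of cutting [x] into the two parts. *)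
Lemma almost_linear_perturb (Q lambda e : R) (J : finType) (psi : J -> C)
    (pt : J -> T) (r : seq (C * T)) (I : finType) (f : I -> C) :
  quasi_linear Omega -> 0 <= Q -> quasi_additive Omega Q -> 0 <= lambda ->
  peak_family psi pt ->
  (forall i, interp r (f i) = f i) ->
  (forall q, q \in r -> rnorm (q.1 - sample psi pt q.1) <= e) ->
  almost_linear_on Omega lambda psi ->
  almost_linear_on Omega
    (lambda + 3 * Q + Q * (size r)%:R * (size r)%:R * e) f.
Proof.
move=> ql Q0 hQ l0 pk rf re [z hz].
pose D (q : C * T) := q.1 - sample psi pt q.1.
exists (fun i => lincomb (fun j => val (f i) (pt j)) z +
  \sum_(q <- r) val (f i) q.2 *: Omega (D q)) => a.
set x := lincomb a f.
have rx : interp r x = x.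
  by rewrite interp_lincomb; apply: eq_bigr => i _; rewrite rf.
have -> : lincomb a (fun i => lincomb (fun j => val (f i) (pt j)) z +
    \sum_(q <- r) val (f i) q.2 *: Omega (D q)) =
  lincomb (fun j => val x (pt j)) z + \sum_(q <- r) Omega (val x q.2 *: D q).
  rewrite lincombD sample_lincomb lincomb_sum; congr (_ + _).
  apply: eq_bigr => q _; rewrite /lincomb ql.1 lincomb_eval scaler_suml.
  by apply: eq_bigr => i _; rewrite scalerA.
pose Px := sample psi pt x.
have xP : x - Px = \sum_(q <- r) val x q.2 *: D q.
  rewrite /D; under eq_bigr do rewrite scalerBr.
  rewrite sumrB -/(interp r x) rx; congr (_ - _).
  rewrite /Px /sample /lincomb.
  under [RHS]eq_bigr do rewrite scaler_sumr.
  rewrite exchange_big; apply: eq_bigr => j _ /=.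
  rewrite -{1}rx /interp cfun_sum_eval scaler_suml.
  by apply: eq_bigr => q _; rewrite scalerA.
have Px1 : rnorm Px <= rnorm x by exact: rnorm_sample.
have xP2 : rnorm (x - Px) <= 2 * rnorm x.
  by apply: le_trans (rnormB _ _) _; lra.
have h1 := hQ Px (x - Px); rewrite [Px + _]addrC subrK in h1.
have h2 := hz (fun j => val x (pt j)); rewrite -/(sample psi pt x) -/Px in h2.
have h3 := quasi_additive_sum Q0 (quasi_linear0 ql) hQ r (fun q => val x q.2 *: D q).
rewrite -xP in h3.
have -> : Omega x - (lincomb (fun j => val x (pt j)) z +
    \sum_(q <- r) Omega (val x q.2 *: D q)) =
  (Omega x - Omega Px - Omega (x - Px)) +
  (Omega Px - lincomb (fun j => val x (pt j)) z) +
  (Omega (x - Px) - \sum_(q <- r) Omega (val x q.2 *: D q)).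
  move: (Omega x) (Omega Px) (Omega (x - Px)) (lincomb _ z) => A B E L.
  move: (\sum_(q <- r) _) => S.
  by rewrite (addrAC A (- B)) subrKA (addrAC A (- E)) subrKA opprD addrA.
have x0 := rnorm_ge0 x.
apply: le_trans (rnormD _ _) _.
rewrite (mulrDl (lambda + 3 * Q)) (mulrDl lambda); apply: lerD.
  apply: le_trans (rnormD _ _) _; rewrite addrC; apply: lerD.
    by apply: le_trans h2 _; rewrite ler_wpM2l.
  apply: le_trans h1 _; rewrite (mulrC 3) -mulrA. apply: ler_wpM2l => //.
  by rewrite addrC; lra.
apply: le_trans h3 _; rewrite -!mulrA; do 2!apply: ler_wpM2l => //.
apply: le_trans (_ : \sum_(q <- r) e * rnorm x <= _); last first.
  by rewrite big_const_seq count_predT iter_addr addr0 mulr_natl.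
rewrite big_seq [leRHS]big_seq; apply: ler_sum => q qr; rewrite rnormZ mulrC.
by apply: ler_pM; rewrite ?rnorm_ge0 // ?re // rnorm_eval.
Qed.

Lemma supported_in_linear (U : set T) (a : K) (f g : C) :
  supported_in U f -> supported_in U g -> supported_in U (a *: f + g).
Proof.
move=> fU gU t Ut; change (a * val f t + val g t = 0).
by rewrite fU // gU // mulr0 addr0.
Qed.

(** The peaks are built for the functions occurring in the evaluation coordinates
of a bad family.  These vanish at [p] and off [U], and the peaks are nonzero only
where they have total size larger than [e]; this gives the neighbourhood [V]
free of the new functions, in which the construction can be repeated. *)
Lemma nontrivial_block (U : set T) p lambda : quasi_linear Omega ->
  open U -> U p -> ~ loc_triv_on Omega (supported_in (U `\ p)) ->
  exists (J : finType) (psi : J -> C) (pt : J -> T) (V : set T),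
    [/\ peak_family psi pt, ~ almost_linear_on Omega lambda psi,
      [/\ open V, V p & V `<=` U] &
      forall j t, val (psi j) t != 0 -> U t /\ ~ V t].
Proof.
move=> ql oU Up nt; have [Q Q0 hQ] := quasi_linear_additive ql.
have [I [f [fU nf]]] : exists (I : finType) (f : I -> C),
    (forall i, supported_in (U `\ p) (f i)) /\
    ~ almost_linear_on Omega (`|lambda| + 3 * Q + 1) f.
  apply: contrapT => no; apply: nt; exists (`|lambda| + 3 * Q + 1) => I f fU.
  by apply: contrapT => nf; apply: no; exists I, f.
have [||g|r [rU rf]] := @eval_coordinates R k T (supported_in (U `\ p))
    [seq f i | i <- enum I].
- by move=> a g h; exact: supported_in_linear.
- by move=> t.
- by move=> /mapP[i _ ->].
(* The choice of e makes the last term in almost_linear_perturb at most 1 for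
approximations within 2 e. *)
pose n : R := (size r)%:R; pose e := (2 * (Q * n * n + 1))^-1.
have n0 : 0 <= n by [].
have Qn0 : 0 <= Q * n * n by rewrite !mulr_ge0.
have e0 : 0 < e by rewrite invr_gt0 mulr_gt0 // ltr_wpDl.
pose F := [seq q.1 | q <- r].
have [J [psi [pt [pk supp approx]]]] := @peak_approximation R k T F e e0.
have FU g : g \in F -> supported_in (U `\ p) g by move=> /mapP[q /rU ? ->].
have sizeU t : ~ (U `\ p) t -> total_size F t = 0.
  move=> Ut; rewrite /total_size big_seq big1 // => g /FU -> //.
  exact: rnorm0.
exists J, psi, pt, (U `&` [set t | total_size F t < e]); split=> //.
- move=> al; apply: nf.
  have := almost_linear_le (ler_norm _) al.
  move=> /(almost_linear_perturb ql Q0 hQ (normr_ge0 _) pk _ _).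
  move=> /(_ (2 * e) r I f) h.
  apply: almost_linear_le (h _ _).
  + rewrite lerD2l -/n.
    have -> : 2 * e = (Q * n * n + 1)^-1.
      by rewrite /e invfM mulrA mulfV ?mul1r ?pnatr_eq0.
    by rewrite ler_pdivrMr ?mul1r ?lerDl // ltr_wpDl.
  + by move=> i; apply: rf; apply: map_f; rewrite mem_enum.
  + by move=> q qr; apply: approx; exact: map_f.
- split.
  + apply: openI => //.
    apply: (open_comp (fun t _ => @total_size_continuous R k T F t) (@open_lt R e)).
  + by split=> //=; rewrite sizeU // => -[_ /(_ erefl)].
  + by move=> t [].
- move=> j t /supp et; have Ut : (U `\ p) t.
    by apply: contrapT => /sizeU s0; rewrite s0 ltNge ltW in et.
  by split; [exact: Ut.1|move=> [_ /= te]; move: (lt_trans et te); rewrite ltxx].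
Qed.

End Blocks.

(** * Copies of c_0 *)

Section IsometricImage.
Context (R : realType) (k : scalar_kind).
Local Notation K := (scalar_field R k).
Context (V W : normedModType K) (J : {linear V -> W}).

Definition image_pred : {pred W} := [pred w | `[< exists v, w = J v >]].

Lemma image_pred_submod : submod_closed image_pred.
Proof.
split; first by apply/asboolP; exists 0; rewrite linear0.
move=> c x y /asboolP[u ->] /asboolP[v ->]; apply/asboolP.
by exists (c *: u + v); rewrite linearP.
Qed.

HB.instance Definition _ :=
  GRing.isSubmodClosed.Build K W image_pred image_pred_submod.

Lemma mem_image_pred v : J v \in image_pred.
Proof. by apply/asboolP; exists v. Qed.

Lemma isometry_continuous (A B : normedModType K) (f : A -> B) :
  (forall x y, rnorm (f x - f y) = rnorm (x - y)) -> continuous f.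
Proof.
move=> fi x; apply/cvgrPdist_lt => e e0.
have /cvgrPdist_lt/(_ _ e0) := @cvg_id _ (nbhs x).
by apply: filterS => y; rewrite -!rnormE fi.
Qed.

Context (J_isometry : forall v, rnorm (J v) = rnorm v).

Lemma isomorphic_image : isomorphic (sub_space image_pred) V.
Proof.
have /choice[f hf] (x : sub_space image_pred) : exists v, val x = J v.
  by have /asboolP := valP x.
pose g v : sub_space image_pred := exist _ (J v) (mem_image_pred v).
have Jinj : injective J.
  move=> u v uv; apply/eqP; rewrite -subr_eq0 -rnorm_eq0.
  by rewrite -J_isometry linearB uv subrr rnorm0.
have linf : linear f.
  by move=> c x y; apply: Jinj; rewrite linearP -!hf.
pose fl : {linear sub_space image_pred -> V} :=
  HB.pack f (GRing.isLinear.Build _ _ _ _ f linf).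
exists fl, g; split.
- by move=> x; apply: val_inj; rewrite /= -hf.
- by move=> v; apply: Jinj; rewrite -hf.
- apply: isometry_continuous => x y.
  by rewrite -linearB -J_isometry -hf.
- apply: isometry_continuous => x y.
  by rewrite rnorm_sub_space /= -linearB J_isometry.
Qed.

End IsometricImage.

Section C0Embedding.
Context {R : realType} {k : scalar_kind} {T : compactHausdorffType}.
Local Notation K := (scalar_field R k).
Local Notation C := (cfun R k T).

Lemma near_rnorm_continuous (F : T -> K^o) :
  (forall t (e : R), 0 < e -> \forall s \near t, rnorm (F t - F s) < e) ->
  continuous F.
Proof.
move=> h t; apply/cvgrPdist_lt => e e0.
have re0 : 0 < scalar_re e.
  by rewrite -(@ltr_scalar_of_real R k) scalar_of_real0 scalar_reK ?ltW.
have := h t _ re0; apply: filterS => s.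
by rewrite -(@ltr_scalar_of_real R k) rnormE scalar_reK ?ltW.
Qed.

Lemma continuous_near_rnorm (F : T -> K^o) : continuous F ->
  forall t (e : R), 0 < e -> \forall s \near t, rnorm (F t - F s) < e.
Proof.
move=> cF t e e0.
have e0' : 0 < scalar_of_real k e by rewrite -scalar_of_real0 ltr_scalar_of_real.
have /cvgrPdist_lt/(_ _ e0') := cF t.
by apply: filterS => s; rewrite -(@ltr_scalar_of_real R k) rnormE.
Qed.

Context (Psi : nat -> C) (pt : nat -> T).
Context (Psi_sum : forall t n,
  \sum_(0 <= i < n) rnorm (val (Psi i) t : K^o) <= 1).
Context (Psi_pt : forall i j, val (Psi i) (pt j) = (i == j)%:R).
Context (Psi_finite : forall t,
  exists n, forall i, (n <= i)%N -> val (Psi i) t = 0).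

Lemma Psi_tail_bound (u : nat -> K) (M : R) m n t : 0 <= M -> (m <= n)%N ->
  (forall i, (m <= i)%N -> rnorm (u i : K^o) <= M) ->
  rnorm (\sum_(m <= i < n) u i * val (Psi i) t : K^o) <= M.
Proof.
move=> M0 mn uM; apply: le_trans (rnorm_sum _ _ _) _.
apply: le_trans (_ : M * \sum_(m <= i < n) rnorm (val (Psi i) t : K^o) <= _).
  rewrite mulr_sumr big_nat [leRHS]big_nat; apply: ler_sum => i /andP[mi _].
  rewrite [X in rnorm X]/(_ *: (_ : K^o)) rnormZ.
  by apply: ler_wpM2r; rewrite ?rnorm_ge0 // uM.
rewrite -[leRHS]mulr1; apply: ler_wpM2l => //.
apply: le_trans (Psi_sum t n); rewrite (big_cat_nat (leq0n m) mn) /=.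
by rewrite lerDr; apply: sumr_ge0 => i _; exact: rnorm_ge0.
Qed.

Lemma sum_kronecker (F : nat -> K) m n : (m < n)%N ->
  \sum_(0 <= i < n) F i * (i == m)%:R = F m.
Proof.
move=> mn; rewrite big_mkord (bigD1 (Ordinal mn)) //= eqxx mulr1 big1 ?addr0 //.
by move=> i im; rewrite (_ : (nat_of_ord i == m) = false) ?mulr0 //; apply/negbTE.
Qed.

Lemma c0_cvg0 (u : c0 R k) (e : R) : 0 < e ->
  exists n, forall i, (n <= i)%N -> rnorm (val u i : K^o) <= e.
Proof.
move=> e0; have /asboolP cu : val u \in @null_pred R k by exact: (valP u).
have e0' : 0 < scalar_of_real k e by rewrite -scalar_of_real0 ltr_scalar_of_real.
have /cvgrPdist_lt/(_ _ e0') [n _ hn] := cu.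
exists n => i ni; apply: ltW; have := hn i ni.
by rewrite sub0r normrN -rnormE ltr_scalar_of_real.
Qed.

(** At each point the series defining the image of [u] has finitely many nonzero
terms, so it makes sense without completeness.  Its tails are uniformly small
since [u] tends to 0 and the absolute values of the [Psi i] add up to at most 1;
hence the sum is continuous.  The points [pt i] recover the coefficients, so the
embedding is isometric. *)
Lemma c0_embedding : exists J : {linear c0 R k -> C},
  (forall u, rnorm (J u) = rnorm u) /\ forall m, exists u, J u = Psi m.
Proof.
have [N hN] := choice Psi_finite.
pose S (u : nat -> K) n t : K^o := \sum_(0 <= i < n) u i * val (Psi i) t.
pose F u t : K^o := S u (N t) t.
have FS u n t : (N t <= n)%N -> F u t = S u n t.
  move=> Nn; rewrite /F /S [RHS](big_cat_nat (leq0n (N t)) Nn) /=.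
  rewrite [X in _ = _ + X]big_nat [X in _ = _ + X]big1 ?addr0 //.
  by move=> i /andP[Ni _]; rewrite hN // mulr0.
have FSdist u n (M : R) t : 0 <= M ->
    (forall i, (n <= i)%N -> rnorm (u i : K^o) <= M) ->
    rnorm (F u t - S u n t) <= M.
  move=> M0 uM; rewrite (FS u (maxn n (N t))) ?leq_maxr // /S.
  rewrite (big_cat_nat (leq0n n) (leq_maxl n (N t))) /= addrAC subrr add0r.
  by apply: Psi_tail_bound; rewrite ?leq_maxl.
have cF (u : c0 R k) : continuous (F (val u)).
  apply: near_rnorm_continuous => t e e0.
  have e3 : 0 < e / 3 by rewrite divr_gt0.
  have [n hn] := c0_cvg0 u e3.
  have cS : continuous (S (val u) n : T -> K^o).
    have -> : S (val u) n = val (\sum_(0 <= i < n) val u i *: Psi i : C).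
      by apply/funext => s; rewrite cfun_sum_eval.
    exact: cfun_continuous.
  have := continuous_near_rnorm cS t e3; apply: filterS => s hs.
  have -> : F (val u) t - F (val u) s =
     (F (val u) t - S (val u) n t) + (S (val u) n t - S (val u) n s)
       - (F (val u) s - S (val u) n s).
    by rewrite addrA subrK opprB addrA subrK.
  apply: le_lt_trans (rnormB _ _) _.
  apply: le_lt_trans (lerD (rnormD _ _) (lexx _)) _.
  have h1 := FSdist (val u) n _ t (ltW e3) hn.
  have h2 := FSdist (val u) n _ s (ltW e3) hn.
  lra.
pose Jf (u : c0 R k) : C := cfun_of (@cF u).
have linJ : linear Jf.
  move=> c u v; apply/val_inj/funext => t.
  change (F (val (c *: u + v)) t = c * F (val u) t + F (val v) t).
  rewrite /F /S mulr_sumr -big_split; apply: eq_bigr => i _ /=.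
  change ((c * val u i + val v i) * val (Psi i) t =
    c * (val u i * val (Psi i) t) + val v i * val (Psi i) t).
  by rewrite mulrDl mulrA.
pose J : {linear c0 R k -> C} := HB.pack Jf (GRing.isLinear.Build _ _ _ _ Jf linJ).
exists J; split=> [u|m].
- apply/eqP; rewrite eq_le; apply/andP; split.
    apply: rnorm_cfun_le => [|t]; first exact: rnorm_ge0.
    apply: Psi_tail_bound => // [|i _]; first exact: rnorm_ge0.
    by rewrite rnorm_c0; apply: supnorm_ub; exact: c0_bounded.
  rewrite [leLHS]rnorm_c0; apply: supnorm_le => [|i]; first exact: rnorm_ge0.
  apply: le_trans (rnorm_eval (J u) (pt i)).
  have -> // : val (J u) (pt i) = val u i.
  rewrite /= (FS _ (maxn (N (pt i)) i.+1)) ?leq_maxl // /S.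
  under eq_bigr do rewrite Psi_pt.
  by rewrite sum_kronecker // leq_maxr.
- pose d : nat -> K^o := fun n => (n == m)%:R.
  have dnull : d \in @null_pred R k.
    apply/asboolP; apply: cvg_near_cst; exists m.+1 => // i /= mi.
    by rewrite /d gtn_eqF.
  exists (exist _ d dnull); apply/val_inj/funext => t.
  rewrite /= (FS _ (maxn (N t) m.+1)) ?leq_maxl // /S.
  under eq_bigr do rewrite mulrC.
  by rewrite sum_kronecker // leq_maxr.
Qed.

End C0Embedding.

(** * Concatenation of the blocks *)

Section Reindexing.

Lemma sum_subset_le (R : numDomainType) (I : eqType) (s r : seq I) (G : I -> R) :
  (forall i, 0 <= G i) -> uniq s -> uniq r -> {subset s <= r} ->
  \sum_(i <- s) G i <= \sum_(i <- r) G i.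
Proof.
move=> G0 us ur sr.
have p : perm_eq s [seq i <- r | i \in s].
  apply: uniq_perm => //; first exact: filter_uniq.
  by move=> i; rewrite mem_filter; case: (boolP (i \in s)) => // /sr ->.
rewrite (perm_big _ p) big_filter big_mkcond; apply: ler_sum => i _.
by case: ifP.
Qed.

Lemma tagged_nat_bijection (I : nat -> finType) (j0 : forall n, I n) :
  exists (to : {n : nat & I n} -> nat) (from : nat -> {n : nat & I n}),
    cancel to from /\ cancel from to.
Proof.
have : ([set: {n : nat & I n}] #= [set: nat])%card.
  apply/card_eqPle; split; first exact: countableP.
  have inj : {in [set: nat] &, injective (fun n => Tagged I (j0 n))}.
    by move=> m n _ _ /(congr1 tag).
  have /card_eqPle[_ le] := inj_card_eq inj.
  exact: card_le_trans le (subset_card_le (@subsetT _ _)).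
move=> /card_set_bijP[to]; rewrite setTT_bijective => -[from ? ?].
by exists to, from.
Qed.

End Reindexing.

Section Concatenation.
Context {R : realType} {k : scalar_kind} {T : compactHausdorffType}.
Local Notation K := (scalar_field R k).
Local Notation C := (cfun R k T).

(** By disjointness of the supports, all functions that are nonzero at a given point
belong to a single block, so the conditions on the whole sequence reduce to those
on one block. *)
Lemma concat_peak_families (I : nat -> finType) (psi : forall n, I n -> C)
    (pt : forall n, I n -> T) :
  (forall n, I n) ->
  (forall n, peak_family (psi n) (pt n)) ->
  (forall m n i j t, val (psi m i) t != 0 -> val (psi n j) t != 0 -> m = n) ->
  exists J : {linear c0 R k -> C},
    (forall u, rnorm (J u) = rnorm u) /\ forall n i, exists u, J u = psi n i.
Proof.
move=> j0 pk disj.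
have [to [from [toK fromK]]] := tagged_nat_bijection j0.
pose q (x : {n : nat & I n}) : C := psi (tag x) (tagged x).
pose s (x : {n : nat & I n}) : T := pt (tag x) (tagged x).
have home t : exists n, forall x, val (q x) t != 0 -> tag x = n.
  have [[x xN0]|no] := pselect (exists x, val (q x) t != 0).
    by exists (tag x) => y yN0; apply: disj yN0 xN0.
  by exists 0%N => x xN0; case: no; exists x.
have [|||J [Jn JPsi]] := @c0_embedding R k T (q \o from) (s \o from).
- move=> t n; have [m hm] := home t.
  pose G x := rnorm (val (q x) t : K^o).
  have G0 x : 0 <= G x by exact: rnorm_ge0.
  rewrite (eq_bigr (fun i => G (from i))) // -(big_map from xpredT G).
  rewrite (bigID (fun x => tag x == m)) /= [X in _ + X]big1 ?addr0; last first.
    move=> x xm; rewrite /G; have [->|/hm/eqP] := eqVneq (val (q x) t) 0.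
      exact: rnorm0.
    by rewrite (negPf xm).
  apply: le_trans ((pk m).1 t).
  rewrite -big_filter -(big_map (fun i => Tagged I i) xpredT G).
  apply: sum_subset_le => //.
  + by rewrite filter_uniq // map_inj_uniq ?iota_uniq //; exact: can_inj fromK.
  + rewrite map_inj_uniq ?index_enum_uniq // => i j /eqP.
    by rewrite -tag_eqE /tag_eq /= eqxx /= tagged_asE => /eqP.
  + move=> [n' i]; rewrite mem_filter /= => /andP[/eqP nm _].
    by case: _ / nm; apply: map_f; exact: mem_index_enum.
- move=> i j /=; rewrite -(inj_eq (can_inj fromK) i j).
  case: (from i) (from j) => [m x] [n y]; rewrite /q /s /=.
  have [mn|mn] := eqVneq m n.
    case: _ / mn y => y; rewrite (pk m).2; congr (_%:R).
    by rewrite -tag_eqE /tag_eq /= eqxx /= tagged_asE.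
  have -> : (existT _ m x == existT _ n y :> {n : nat & I n}) = false.
    by rewrite -tag_eqE /tag_eq /= (negPf mn).
  apply/eqP; apply: contraNT mn => xN0; apply/eqP.
  apply: disj xN0 (_ : val (psi n y) (pt n y) != 0).
  by rewrite (pk n).2 eqxx oner_eq0.
- move=> t; have [m hm] := home t.
  exists (\max_(j : I m) (to (Tagged I j)).+1)%N => i le_i.
  apply/eqP; apply/negPn/negP => /= iN0; have := hm _ iN0.
  move: (fromK i) le_i; case: (from i) => [n x] /= <- le_i nm.
  case: _ / nm in le_i *.
  by move: (leq_trans (leq_bigmax (F := fun j => (to (Tagged I j)).+1) x) le_i);
    rewrite ltnn.
- exists J; split=> // n i; have [u hu] := JPsi (to (Tagged I i)).
  by exists u; rewrite hu /= toK.
Qed.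

End Concatenation.

(** * A bad point yields a copy of c_0 *)

(** [block_rest] is the neighbourhood of the bad point on which the peaks of the
block vanish, and to which the later blocks are confined. *)
Record block_data (C T : Type) := BlockData {
  block_index : finType;
  block_peak : block_index -> C;
  block_point : block_index -> T;
  block_rest : set T }.

Section Dichotomy.
Context {R : realType} {k : scalar_kind} {T : compactHausdorffType}.
Local Notation K := (scalar_field R k).
Local Notation C := (cfun R k T).
Context {Y : normedModType K} (Omega : C -> Y).
Context (ql : quasi_linear Omega).

(** The [n]-th block is built in the region left by the previous ones so as not to
be nearly linear with constant [n].  A constant for [Omega] on the copy of c_0
spanned by all blocks would serve for every block. *)
Lemma nontrivial_c0_copy p :
  (forall U, open U -> U p -> ~ loc_triv_on Omega (supported_in U)) ->
  exists E : submodClosed C,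
    isomorphic (sub_space E) (c0 R k) /\ ~ locally_trivial (restrict_to Omega E).
Proof.
move=> nt.
pose spec (U : set T) (n : nat) (D : block_data C T) :=
  [/\ peak_family (@block_peak _ _ D) (@block_point _ _ D),
      ~ almost_linear_on Omega n%:R (@block_peak _ _ D),
      [/\ open (block_rest D), block_rest D p & block_rest D `<=` U] &
      forall (j : block_index D) t, val (block_peak j) t != 0 ->
        U t /\ ~ block_rest D t].
have /choice[D hD] (Un : set T * nat) :
    exists D, open Un.1 -> Un.1 p -> spec Un.1 Un.2 D.
  have [[oU Up]|no] := pselect (open Un.1 /\ Un.1 p); last first.
    have psi0 : void -> C by case.
    have pt0 : void -> T by case.
    by exists (BlockData psi0 pt0 setT) => oU Up; case: no.
  have ntp : ~ loc_triv_on Omega (supported_in (Un.1 `\ p)).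
    by move=> /(loc_triv_on_add_point ql oU Up); exact: nt.
  have [J [psi [pt [V hV]]]] :=
    @nontrivial_block _ _ _ _ _ Un.1 p Un.2%:R ql oU Up ntp.
  by exists (BlockData psi pt V).
pose U := fix U n := if n is m.+1 then block_rest (D (U m, m)) else [set: T].
have Uop n : open (U n) /\ U n p.
  elim: n => [|n [on pn]]; first by split=> //; exact: openT.
  by have [_ _ [? ? _] _] := hD (U n, n) on pn.
have hB n : spec (U n) n (D (U n, n)).
  by have [on pn] := Uop n; exact: (hD (U n, n)).
have Udec m n : (m <= n)%N -> U n `<=` U m.
  elim: n => [|n IH]; first by rewrite leqn0 => /eqP ->.
  rewrite leq_eqVlt => /predU1P[->//|/IH h]; apply: subset_trans h.
  by have [_ _ [_ _ ?] _] := hB n.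
pose I n := block_index (D (U n, n)).
pose psi n (i : I n) := block_peak i.
pose pt n (i : I n) := block_point i.
have j0 n : I n.
  (* A block cannot be empty: on the zero space Omega is linear. *)
  suff /cid[] : exists i : I n, True by [].
  apply: contrapT => no; have [_ + _ _] := hB n; apply.
  have lc0 (V : lmodType K) a (e : I n -> V) : lincomb a e = 0.
    by rewrite /lincomb big1 // => i _; case: no; exists i.
  by exists (fun=> 0) => a; rewrite !lc0 quasi_linear0 // subrr !rnorm0 mulr0.
have lt_disj m n (i : I m) (j : I n) t : (m < n)%N ->
    val (psi m i) t != 0 -> val (psi n j) t != 0 -> False.
  move=> mn iN0 jN0; have [_ _ _ /(_ _ _ iN0)[_]] := hB m; apply.
  have [_ _ _ /(_ _ _ jN0)[Unt _]] := hB n.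
  exact: (Udec m.+1 n).
have [|m n i j t iN0 jN0|J [Jn JPsi]] := @concat_peak_families R k T I psi pt j0.
- by move=> n; have [] := hB n.
- case: (ltngtP m n) => // mn; first by case: (lt_disj _ _ _ _ _ mn iN0 jN0).
  by case: (lt_disj _ _ _ _ _ mn jN0 iN0).
exists (image_pred J : submodClosed C); split; first exact: isomorphic_image.
move=> /(locally_trivial_loc_triv_on (quasi_linear_restrict _ ql))[lambda hl].
pose n := (Num.trunc lambda).+1.
have [_ nB _ _] := hB n; apply: nB.
have memE i : psi n i \in image_pred J.
  by have [u <-] := JPsi n i; exact: mem_image_pred.
pose e i : sub_space (image_pred J : submodClosed C) := exist _ (psi n i) (memE i).
apply: almost_linear_le (_ : lambda <= n%:R) _; first exact/ltW/truncnS_gt.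
have [y hy] := hl (I n) e (fun=> Logic.I).
exists y => a; have := hy a.
have ve : \val (lincomb a e) = lincomb a (psi n) by rewrite raddf_sum.
by rewrite rnorm_sub_space /restrict_to /= ve.
Qed.

End Dichotomy.

Theorem theorem2p1 (R : realType) (k : scalar_kind) (T : compactHausdorffType)
    (Y : completeNormedModType (scalar_field R k))
    (Omega : cfun R k T -> Y) (hOmega : quasi_linear Omega) :
  locally_trivial Omega \/
  exists E : submodClosed (cfun R k T),
    isomorphic (sub_space E) (c0 R k) /\ ~ locally_trivial (restrict_to Omega E).
Proof.
have [[p hp]|no] := pselect (exists p, forall U, open U -> U p ->
    ~ loc_triv_on Omega (supported_in U)).
  by right; exact: nontrivial_c0_copy hp.
left; apply: loc_triv_on_locally_trivial => //; apply: loc_triv_on_glue => // p.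
apply: contrapT => nop; apply: no; exists p => U oU Up lt.
by apply: nop; exists U.
Qed.
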